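(* $\displaystyle\lim_{n \to \infty} \frac{\delta_n(\chi_c,\mathfrak{C})}{n} = \frac{1}{2}$, where $\delta_n(\chi_c,\mathfrak{C})=\max\{d_T(\chi_c,\mathfrak{C}) : T \text{ is a tree on } n \text{ vertices}\}$.
   Context: For a tree $T$ and $u,v\in V(T)$, $d_T(u,v)$ is the number of edges of the $u$-$v$ path; for $X,Y\subseteq V(T)$, $d(X,Y)=\min\{d_T(x,y): x\in X, y\in Y\}$. The Laplacian matrix of $T$ is $L(T)=D(T)-A(T)$ (degree matrix minus adjacency matrix); its second smallest eigenvalue is $\mu(T)$, and a Fiedler vector is an eigenvector of $L(T)$ for $\mu(T)$. For a Fiedler vector $Y$, a vertex $v$ is a characteristic vertex with respect to $Y$ if either $Y(v)=0$ and some neighbour $u$ of $v$ has $Y(u)\neq 0$, or some neighbour $u$ of $v$ has $Y(v)Y(u)<0$. The characteristic center $\chi_c(T)$ is the set of vertices that are characteristic vertices with respect to some Fiedler vector (for trees this set is the same for each Fiedler vector). For $u,v\in V(T)$, $f_T(v,u)$ is the number of subtrees (connected subgraphs) of $T$ containing both $v$ and $u$. The eccentric subtree number of $v$ is $\epsilon_T(v)=\min\{f_T(v,u):u\in V(T)\}$, and the core center $\mathfrak{C}(T)$ is the set of vertices maximizing $\epsilon_T$. Write $d_T(\chi_c,\mathfrak{C})=d(\chi_c(T),\mathfrak{C}(T))$. *)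

(* Defs.v *)
From HB Require Import structures.
From mathcomp Require Import all_boot all_order all_algebra.
From mathcomp Require Import all_classical all_reals all_analysis.

Set Implicit Arguments.
Unset Strict Implicit.
Unset Printing Implicit Defensive.

Import Order.TTheory GRing.Theory Num.Theory.

Local Open Scope ring_scope.

Section Graphs.
Variable T : finType.
Implicit Types (E F : {set {set T}}) (S X Y : {set T}) (u v x y : T).

(* A graph on T is given by its set E of edges, an edge being a set of two
   vertices. *)
Definition simple_edges E : bool := [forall A in E, #|A| == 2%N].

Definition adj E : rel T := fun x y => [set x; y]%SET \in E.

(* Connectedness of the graph with vertex set S and edge set F; the null graph
   is not connected. *)
Definition connected_graph S F : bool :=
  (S != finset.set0) && [forall x in S, forall y in S, connect (adj F) x y].

Definition acyclic E : Prop :=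
  forall c : seq T, ucycle (adj E) c -> (size c <= 2)%N.

Definition is_tree E : Prop :=
  [/\ simple_edges E, connected_graph (finset.setTfor T) E & acyclic E].

(* The path from x to y, without its first vertex x, so that its size is its
   number of edges. It is unique when E is a tree. *)
Definition tree_path E x y : seq T :=
  xget [::] [set p | [/\ path (adj E) x p, uniq (x :: p) & last x p = y]]%classic.

Definition tree_dist E x y : nat := size (tree_path E x y).

(* The minimum of the distances from X to Y. The initial value #|T| exceeds all
   distances in a tree, so it matters only when X or Y is empty. *)
Definition set_dist E X Y : nat :=
  \big[minn/#|T|]_(x in X) \big[minn/#|T|]_(y in Y) tree_dist E x y.

Definition is_subgraph E (H : {set T} * {set {set T}}) : bool :=
  (H.2 \subset E) && [forall A in H.2, A \subset H.1].

Definition num_subtrees E v u : nat :=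
  #|[pred H : {set T} * {set {set T}} |
      [&& is_subgraph E H, connected_graph H.1 H.2, v \in H.1 & u \in H.1]]|.

Definition ecc_subtree E v : nat :=
  \big[minn/num_subtrees E v v]_(u : T) num_subtrees E v u.

Definition core_center E : {set T} :=
  finset (fun v => [forall w, ecc_subtree E w <= ecc_subtree E v]%N).

End Graphs.

Section Fiedler.
Variables (R : realType) (n : nat).
Implicit Types (E : {set {set 'I_n}}) (Y : 'cV[R]_n) (v : 'I_n).

Definition degree_mx E : 'M[R]_n :=
  diag_mx (\row_i #|[pred j | adj E i j]|%:R).

Definition adj_mx E : 'M[R]_n := \matrix_(i, j) (adj E i j)%:R.

Definition laplacian E : 'M[R]_n := degree_mx E - adj_mx E.

(* The eigenvalues of A with multiplicity, in nondecreasing order, provided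
   that they are all in R. *)
Definition spectrum (A : 'M[R]_n) : seq R :=
  xget [::] [set s | sorted <=%R s /\
                     char_poly A = \prod_(z <- s) ('X - z%:P)]%classic.

Definition alg_connectivity E : R := (spectrum (laplacian E))`_1.

Definition fiedler_vector E Y : Prop :=
  Y != 0 /\ laplacian E *m Y = alg_connectivity E *: Y.

Definition char_vertex E Y v : Prop :=
  (Y v 0 = 0 /\ exists2 u, adj E v u & Y u 0 != 0) \/
  (exists2 u, adj E v u & Y v 0 * Y u 0 < 0).

Definition char_center E : {set 'I_n} :=
  finset (fun v => `[< exists2 Y, fiedler_vector E Y & char_vertex E Y v >]).

End Fiedler.

Definition delta_char_core (R : realType) (n : nat) : nat :=
  \max_(E : {set {set 'I_n}} | `[< is_tree E >])
     set_dist E (char_center R E) (core_center E).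

(* Main.v *)
Require Import Defs.
From mathcomp Require Import all_boot all_order all_algebra.
From mathcomp Require Import all_classical all_reals all_analysis.
From mathcomp Require Import complex.
From mathcomp Require Import zify ring lra.

(** The theorem rests on one fact about an arbitrary tree on [n] vertices: a
    characteristic vertex is at distance at most [(n + 1) / 2] from every other
    vertex ([char_center_dist]).  The upper bound is then immediate, since the
    characteristic center is not empty.

    To see the fact, let a Fiedler vector [Y] be nonpositive at [x0], let a path
    with [q] edges start at [x0] and enter a branch at [x0], and let [Y] be
    positive somewhere outside this branch, in the rest [O] of the tree.  Then
    [q <= #|O|] ([branch_bound]).  Indeed the positive part [g] of [Y] on [O] has Rayleigh
    quotient at most [mu], the algebraic connectivity.  Sort its values in
    decreasing order: since the tree is connected, each gap between two
    consecutive values is crossed by some edge, so the energy of [g] is at least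
    the sum of the squared gaps ([rearrangement]).  Lay the sorted values along
    the path, the largest one deepest in the branch, and extend them constantly
    off the path: the energy of this function [f] is at most that sum of squared
    gaps ([transplant]).  If [q > #|O|], there is room for a second copy of the
    largest value, so [f] has a larger norm than [g], hence a Rayleigh quotient
    below [mu].  The supports of [f] and [g] are disjoint and not joined by an
    edge, so a suitable combination [a f - b g] is orthogonal to the constants
    and has Rayleigh quotient below [mu] ([energy_gt_of_separated]); this
    contradicts the minimality of [mu].  At a characteristic vertex, [Y]
    vanishes or changes sign across an edge, and in both cases the bound applies
    to [Y] or [- Y] ([char_vertex_path_bound]).

    For the lower bound, take a broom: a path with [n - k] vertices and [k]
    leaves attached to its last vertex, with [k] about [log n].  The
    characteristic vertices are within about [n / 2] of the last path vertex,
    hence no closer than about [n / 2 - k] to the first one.  The core center,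
    on the other hand, is among the first three path vertices.  Indeed the third
    vertex shares at most [2 ^ k + n] subtrees with the first one, no fewer with
    the second one, and at least [3 * 2 ^ (k - 1)] with any later vertex; since
    [n <= 2 ^ (k - 1)], its eccentric subtree number is attained at the first
    vertex.  A vertex beyond the third shares fewer subtrees with the first
    vertex than the third does, so it has a smaller eccentric subtree number
    ([core_center_broom]). *)

Set Implicit Arguments.
Unset Strict Implicit.
Unset Printing Implicit Defensive.

Import Order.TTheory GRing.Theory Num.Theory.
Import numFieldNormedType.Exports.

Local Open Scope ring_scope.

(** * Deleting an edge of a tree *)

Section TreeCuts.
Variable T : finType.
Implicit Types (E : {set {set T}}) (u v x y : T).

Lemma adjC E x y : adj E x y = adj E y x.
Proof. by rewrite /adj finset.setUC. Qed.

Lemma connect_adjC E x y : connect (adj E) x y = connect (adj E) y x.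
Proof. exact: (sym_connect_sym (adjC E)). Qed.

Lemma adj_irrefl E x : simple_edges E -> adj E x x = false.
Proof.
move=> /forall_inP sE; apply/negP => /sE.
by rewrite finset.setUid cards1.
Qed.

(** In a tree, one of the two components left by deleting the edge [xy]. *)
Definition side E x y : {set T} :=
  finset (fun v => connect (adj (E :\ [set x; y]%SET)) y v).

Lemma side_start E x y : y \in side E x y.
Proof. by rewrite inE connect0. Qed.

(** Every edge of a tree is a bridge: a path from [y] to [x] that avoids the
    edge [xy] would close up to a cycle with it. *)
Lemma tail_notin_side E x y : simple_edges E -> acyclic E -> adj E x y ->
  x \notin side E x y.
Proof.
move=> sE aE xy; rewrite inE; apply/negP => /connectP[p0 p0P p0x].
case/shortenP: p0P p0x => p pP up _ px.
have sub : subrel (adj (E :\ [set x; y]%SET)) (adj E).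
  by move=> u v; rewrite /adj inE => /andP[].
have : ucycle (adj E) (y :: p).
  by rewrite /ucycle /cycle rcons_path (sub_path sub) // -px up xy.
move=> /aE /=; case: p pP px {up} => [|z [|? ?]] //=.
  by move=> _ xEy; rewrite xEy adj_irrefl in xy.
rewrite andbT => yz xz _; move: yz; rewrite -xz.
by rewrite /adj finset.setUC finset.setD11.
Qed.

Lemma side_step E x y u v : adj E u v -> [set u; v]%SET != [set x; y]%SET ->
  u \in side E x y -> v \in side E x y.
Proof.
move=> uv ne; rewrite !inE => yu; apply: connect_trans yu (connect1 _).
by rewrite /adj in_setD1 ne.
Qed.

Lemma set2_inj (a b c d : T) : [set a; b]%SET = [set c; d]%SET ->
  (a = c /\ b = d) \/ (a = d /\ b = c).
Proof.
move=> e.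
have := finset.set21 a b; have := finset.set22 a b.
have := finset.set21 c d; have := finset.set22 c d.
rewrite e -{1 2}e !inE => /pred2P[] dd /pred2P[] cc /pred2P[] bb /pred2P[] aa;
  subst; auto.
Qed.

Lemma side_boundary E x y u v : simple_edges E -> acyclic E -> adj E x y ->
  adj E u v -> u \in side E x y -> v \notin side E x y -> u = y /\ v = x.
Proof.
move=> sE aE xy uv us vs.
have [e|ne] := eqVneq [set u; v]%SET [set x; y]%SET; last first.
  by rewrite (side_step uv ne us) in vs.
have [[ux _]|//] := set2_inj e.
by move: us; rewrite ux (negbTE (tail_notin_side sE aE xy)).
Qed.

Section AlongPath.
Variables (E : {set {set T}}) (x0 : T) (s : seq T).
Hypotheses (sE : simple_edges E) (aE : acyclic E).
Hypotheses (pP : path (adj E) x0 s) (uP : uniq (x0 :: s)).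
Let P i := nth x0 (x0 :: s) i.

Lemma path_adj i : (i < size s)%N -> adj E (P i) (P i.+1).
Proof. by move=> lt_i; have /(pathP x0)/(_ i lt_i) := pP. Qed.

Lemma path_vertex_inj i j : (i <= size s)%N -> (j <= size s)%N ->
  P i = P j -> i = j.
Proof.
by move=> li lj /eqP; rewrite /P nth_uniq ?ltnS // => /eqP.
Qed.

(** The [j]-th edge of a simple path separates its first [j + 1] vertices from the
    others, because the rest of the path does not use this edge. *)
Lemma mem_side_path i j : (i <= size s)%N -> (j < size s)%N ->
  (P i \in side E (P j) (P j.+1)) = (j < i)%N.
Proof.
move=> li lj.
have step k : (k < size s)%N -> k <> j -> P k \in side E (P j) (P j.+1) ->
    P k.+1 \in side E (P j) (P j.+1).
  move=> lk kj; apply: side_step (path_adj lk) _.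
  apply/eqP => /set2_inj[] [] e1 e2.
    by apply: kj; apply: path_vertex_inj e1; lia.
  have := path_vertex_inj (ltnW lk) lj e1.
  have := path_vertex_inj lk (ltnW lj) e2; lia.
have up k d : (forall l, (k <= l < k + d)%N -> l <> j) -> (k + d <= size s)%N ->
    P k \in side E (P j) (P j.+1) -> P (k + d)%N \in side E (P j) (P j.+1).
  elim: d => [|d IH] ne le Pk; first by rewrite addn0.
  rewrite addnS; apply: step; [by lia|by apply: ne; lia|].
  apply: IH => // [l ll|]; [by apply: ne; lia | lia].
have [ji|ij] := ltnP j i.
  rewrite -(subnKC ji); apply: up; [lia|lia|exact: side_start].
apply/negP => Pi.
have := tail_notin_side sE aE (path_adj lj); rewrite -{1}(subnKC ij).
by rewrite (up _ _ _ _ Pi) //; lia.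
Qed.

End AlongPath.

End TreeCuts.

Lemma connect_ind (T : finType) (r : rel T) (a : pred T) (x v : T) :
  a x -> (forall y z, a y -> r y z -> a z) -> connect r x v -> a v.
Proof.
move=> ax step /connectP[p]; elim: p x ax => [|z p IH] x ax /= => [_ -> //|].
by case/andP=> /(step _ _ ax) az; exact: IH.
Qed.

Lemma crossing_edge (T : finType) (E : {set {set T}}) (A : pred T) (x y : T) :
  connect (adj E) x y -> A x -> ~~ A y -> exists u v, [/\ adj E u v, A u & ~~ A v].
Proof.
move=> xy Ax Ay.
have [/existsP[u /existsP[v /and3P[uv Au Av]]]|no] :=
    boolP [exists u, exists v, [&& adj E u v, A u & ~~ A v]].
  by exists u, v.
have : A y; last by rewrite (negbTE Ay).
apply: (connect_ind Ax) xy => u v Au uv; apply: contraNT no => Av.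
by apply/existsP; exists u; apply/existsP; exists v; rewrite uv Au.
Qed.

(** * Dirichlet energy on a tree *)

Section Energy.
Variables (R : realFieldType) (T : finType) (E : {set {set T}}).
Implicit Types (f g : T -> R).

(** The sum runs over ordered pairs, so this is twice the quadratic form of the
    Laplacian. *)
Definition energy f : R :=
  \sum_u \sum_v (adj E u v)%:R * (f u - f v) ^+ 2.

Definition lap f u : R := \sum_v (adj E u v)%:R * (f u - f v).

(** Summation by parts. *)
Lemma energyE f g :
  \sum_u \sum_v (adj E u v)%:R * ((f u - f v) * (g u - g v)) =
  2 * \sum_u f u * lap g u.
Proof.
have swap : \sum_u \sum_v (adj E u v)%:R * (- f v * (g u - g v)) =
    \sum_u f u * lap g u.
  rewrite exchange_big /=; apply: eq_bigr => u _; rewrite /lap mulr_sumr.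
  by apply: eq_bigr => v _; rewrite adjC; ring.
rewrite mulr_natl mulr2n -{2}swap -big_split /=; apply: eq_bigr => u _.
rewrite /lap mulr_sumr -big_split /=; apply: eq_bigr => v _; ring.
Qed.

End Energy.

Section Transplant.
Variables (R : realFieldType) (T : finType) (E : {set {set T}}).

(** The function is [\sum_j (H j.+1 - H j) 1_(F j)], where [F j] is the part of the
    tree beyond the [j]-th edge of the path.  It takes the value [H i] at the
    [i]-th vertex of the path and is constant on whatever hangs from that vertex,
    so only the edges of the path carry energy. *)
Lemma transplant (x0 : T) (s : seq T) (H : nat -> R) :
  simple_edges E -> acyclic E -> path (adj E) x0 s -> uniq (x0 :: s) ->
  H 0%N = 0 -> {homo H : i j / (i <= j)%N >-> i <= j} ->
  exists f : T -> R,
  [/\ forall v, 0 <= f v,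
      forall v, v \notin side E x0 (nth x0 s 0) -> f v = 0,
      \sum_(i < (size s).+1) H i ^+ 2 <= \sum_v f v ^+ 2
    & energy E f <= 2 * \sum_(i < size s) (H i.+1 - H i) ^+ 2].
Proof.
move=> sE aE pP uP H0 Hm.
pose P i := nth x0 (x0 :: s) i.
pose F i := side E (P i) (P i.+1).
pose g i := H i.+1 - H i.
pose f v := \sum_(j < size s) g j * (v \in F j)%:R.
have g0 i : 0 <= g i by rewrite subr_ge0 Hm.
have fP i : (i <= size s)%N -> f (P i) = H i.
  move=> li; rewrite /f (eq_bigr (fun j : 'I__ => g j * (j < i)%N%:R)); last first.
    by move=> j _; rewrite /F (mem_side_path sE aE pP uP).
  elim: i li => [|i IH] li.
    by rewrite big1 ?H0 // => j _; rewrite mulr0.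
  rewrite -[RHS](subrK (H i)) -/(g i) -(IH (ltnW li)) addrC.
  have -> : g i = \sum_(j < size s) g j * (j == i :> nat)%:R.
    rewrite (bigD1 (Ordinal li)) //= eqxx mulr1 big1 ?addr0 // => j ji.
    by rewrite -val_eqE /= in ji; rewrite (negbTE ji) mulr0.
  rewrite -big_split; apply: eq_bigr => j _ /=; rewrite -mulrDr -natrD.
  by congr (_ * _%:R); case: (ltngtP j i); lia.
exists f; split.
- by move=> v; apply: sumr_ge0 => j _; rewrite mulr_ge0.
- (* a walk from P j.+1 that left F 0 would pass through P 1, which is on the
     near side of the j-th edge *)
  move=> v vF; rewrite /f big1 // => j _.
  suff -> : v \in F j = false by rewrite mulr0.
  apply: contraNF vF; rewrite -[side _ _ _]/(F 0%N) => vj.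
  have ls : (0 < size s)%N by case: j {vj} => ? /=; lia.
  have e0 := path_adj pP ls.
  move: vj; have [->|j0] := eqVneq (j : nat) 0%N; [by []|move=> vj].
  suff /andP[] : (v \in F 0%N) && (v \in F j) by [].
  have vc : connect (adj (E :\ [set P j; P j.+1]%SET)) (P j.+1) v.
    by move: vj; rewrite inE.
  apply: (connect_ind (a := fun w => (w \in F 0%N) && (w \in F j))) vc.
    by rewrite side_start (mem_side_path sE aE pP uP) // andbT; lia.
  move=> y z /andP[yF yj]; rewrite /adj in_setD1 => /andP[ne yz].
  rewrite (side_step yz ne yj) andbT; apply/negPn/negP => zF.
  have [ey _] := side_boundary sE aE e0 yz yF zF.
  by move: yj; rewrite ey (mem_side_path sE aE pP uP) //; lia.
- pose Q (i : 'I_(size s).+1) := P i.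
  have Qi : injective Q.
    move=> i j /(path_vertex_inj uP) e; apply: val_inj => /=.
    by apply: e; rewrite -ltnS.
  rewrite (bigID [in codom Q]) /= -[leLHS]addr0 lerD //; last first.
    by apply: sumr_ge0 => v _; exact: sqr_ge0.
  have uq : uniq (codom Q) by rewrite map_inj_uniq ?enum_uniq.
  rewrite -(big_uniq _ uq) /= big_map big_enum /=; apply: ler_sum => i _.
  by rewrite fP // -ltnS.
- pose hit u v (j : 'I_(size s)) : R :=
    ((u == P j) && (v == P j.+1))%:R + ((u == P j.+1) && (v == P j))%:R.
  have pw u v : (adj E u v)%:R * (f u - f v) ^+ 2 <=
      \sum_(j < size s) g j ^+ 2 * hit u v j.
    have rhs0 (j : 'I_(size s)) : 0 <= g j ^+ 2 * hit u v j.
      by rewrite mulr_ge0 ?sqr_ge0 // addr_ge0.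
    have one (j : 'I_(size s)) : 1 <= hit u v j -> (f u - f v) ^+ 2 = g j ^+ 2 ->
        (f u - f v) ^+ 2 <= \sum_(j < size s) g j ^+ 2 * hit u v j.
      move=> h1 e; rewrite (bigD1 j) //= e.
      rewrite -[leLHS]addr0 lerD ?sumr_ge0 // ler_peMr ?sqr_ge0 //.
    have [uv|_] := boolP (adj E u v); last by rewrite mul0r sumr_ge0.
    rewrite mul1r.
    have [/existsP[j]|/existsPn same] :=
        boolP [exists j : 'I_(size s), (u \in F j) != (v \in F j)].
      have ej := path_adj pP (ltn_ord j).
      have gj : f (P j.+1) - f (P j) = g j by rewrite !fP //; exact: ltnW.
      have [uj|uj] := boolP (u \in F j); have [vj|vj] := boolP (v \in F j) => // _.
        have [eu ev] := side_boundary sE aE ej uv uj vj.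
        by apply: (one j); rewrite ?eu ?ev ?gj // /hit !eqxx /= lerDr.
      have vu : adj E v u by rewrite adjC.
      have [ev eu] := side_boundary sE aE ej vu vj uj.
      apply: (one j); rewrite eu ev; first by rewrite /hit !eqxx /= lerDl.
      by rewrite -sqrrN opprB gj.
    suff -> : f u = f v by rewrite subrr expr0n sumr_ge0.
    by apply: eq_bigr => j _; have /negPn/eqP -> := same j.
  apply: le_trans (_ : \sum_u \sum_v \sum_(j < size s) g j ^+ 2 * hit u v j <= _).
    by apply: ler_sum => u _; apply: ler_sum => v _; exact: pw.
  rewrite mulr_sumr; under eq_bigr => u _ do rewrite exchange_big /=.
  rewrite exchange_big /=; apply: ler_sum => j _.
  have one (a b : T) : \sum_u \sum_v ((u == a) && (v == b))%:R = 1 :> R.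
    rewrite (bigD1 a) //= (bigD1 b) //= !eqxx big1 ?addr0.
      by rewrite big1 ?addr0 // => u /negbTE ua; apply: big1 => v _; rewrite ua.
    by move=> v /negbTE vb; rewrite vb andbF.
  rewrite (eq_bigr (fun u => g j ^+ 2 * \sum_v hit u v j)); last first.
    by move=> u _; rewrite mulr_sumr.
  rewrite -mulr_sumr /hit; under eq_bigr => u _ do rewrite big_split /=.
  by rewrite big_split /= !one mulrC lexx.
Qed.

End Transplant.

Section Rearrangement.
Variables (R : realFieldType) (T : finType) (E : {set {set T}}).

(** For nonnegative gaps, the sum of the squares is at most the square of the sum. *)
Lemma sum_sqr_gaps (h : nat -> R) (a b : nat) :
  {homo h : i j / (i <= j)%N >-> j <= i} -> (a <= b)%N ->
  \sum_(a <= i < b) (h i - h i.+1) ^+ 2 <= (h a - h b) ^+ 2.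
Proof.
move=> hm; elim: b => [|b IH].
  by rewrite leqn0 => /eqP ->; rewrite big_geq // sqr_ge0.
rewrite leq_eqVlt => /predU1P[->|]; first by rewrite big_geq // sqr_ge0.
rewrite ltnS => ab; rewrite big_nat_recr //=.
have := IH ab; have := hm _ _ ab; have := hm _ _ (leqnSn b).
by nra.
Qed.

(** The sequence [h] lists the values of [f] on [O] in decreasing order, followed
    by zeros.  For [i < #|O|], the vertices of rank at most [i] form a nonempty
    set that misses [w], so some edge joins a vertex of rank at most [i] to one
    of larger rank.  The squared difference of [f] along an edge is at least the
    sum of the squared gaps between the two ranks, so each gap is counted at
    least once, and twice over ordered pairs. *)
Lemma rearrangement (O : {set T}) (w : T) (f : T -> R) :
  (forall x y, connect (adj E) x y) ->
  (forall v, 0 <= f v) -> (forall v, v \notin O -> f v = 0) -> w \notin O ->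
  exists h : nat -> R,
  [/\ {homo h : i j / (i <= j)%N >-> j <= i},
      forall i, (#|O| <= i)%N -> h i = 0,
      \sum_(i < #|O|) h i ^+ 2 = \sum_v f v ^+ 2,
      forall v, f v <= h 0%N
    & 2 * \sum_(i < #|O|) (h i - h i.+1) ^+ 2 <= energy E f].
Proof.
move=> cE f0 fO wO.
pose s := sort (fun u v => f v <= f u) (enum O).
have ss : size s = #|O| by rewrite size_sort -cardE.
have us : uniq s by rewrite sort_uniq enum_uniq.
have ms v : (v \in s) = (v \in O) by rewrite mem_sort mem_enum.
have so : sorted (fun x y : R => y <= x) (map f s).
  by rewrite sorted_map; apply: sort_sorted => u v; exact: le_total.
pose h i := nth 0 (map f s) i.
have hz i : (#|O| <= i)%N -> h i = 0.
  by move=> le; rewrite /h nth_default // size_map ss.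
have h_ge0 i : 0 <= h i.
  have [lt|ge] := ltnP i #|O|; last by rewrite hz.
  by rewrite /h (nth_map w) ?ss.
have hm : {homo h : i j / (i <= j)%N >-> j <= i}.
  move=> i j ij; have [lt|ge] := ltnP j #|O|; last by rewrite (hz j ge).
  apply: (sorted_leq_nth _ _ 0 so) => //.
  - by move=> x y z /= yx xz; exact: le_trans xz yx.
  - by rewrite inE size_map ss (leq_ltn_trans ij).
  - by rewrite inE size_map ss.
pose rk v := index v s.
have hrk v : h (rk v) = f v.
  have [vO|vO] := boolP (v \in O).
    by rewrite /h (nth_map w) ?index_mem ?ms // nth_index // ms.
  by rewrite fO // hz // /rk -ss memNindex ?ms.
exists h; split=> //.
- transitivity (\sum_(x <- map f s) x ^+ 2).
    by rewrite (big_nth 0) size_map ss big_mkord.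
  rewrite big_map (perm_big (enum O)) ?perm_sort //= big_enum /=.
  rewrite [RHS](bigID [in O]) /= [X in _ = _ + X]big1 ?addr0 // => v vO.
  by rewrite fO // expr0n.
- by move=> v; rewrite -hrk hm.
pose cross u v i := (rk u <= i < rk v)%N || (rk v <= i < rk u)%N.
have pw u v : \sum_(i < #|O|) (h i - h i.+1) ^+ 2 * (cross u v i)%:R <=
    (f u - f v) ^+ 2.
  wlog uv : u v / (rk u <= rk v)%N.
    move=> W; have [/W //|/ltnW/W] := leqP (rk u) (rk v).
    rewrite -[X in _ <= X -> _]sqrrN opprB; apply: le_trans.
    by apply: ler_sum => i _; rewrite /cross orbC.
  rewrite -(hrk u) -(hrk v); apply: le_trans (sum_sqr_gaps hm uv).
  rewrite (bigID (fun i : 'I__ => cross u v i)) /=.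
  rewrite [X in _ + X]big1 ?addr0; last by move=> i /negbTE ->; rewrite mulr0.
  have rkv : (rk v <= #|O|)%N by rewrite -ss index_size.
  rewrite (big_nat_widen _ _ #|O|) // (big_nat_widenl _ 0) // big_mkord.
  under eq_bigr => i -> do rewrite mulr1.
  rewrite le_eqVlt; apply/orP; left; apply/eqP; apply: eq_bigl => i.
  by rewrite /cross; lia.
apply: le_trans (_ : \sum_u \sum_v (adj E u v)%:R *
   \sum_(i < #|O|) (h i - h i.+1) ^+ 2 * (cross u v i)%:R <= _); last first.
  by apply: ler_sum => u _; apply: ler_sum => v _; rewrite ler_wpM2l.
rewrite (eq_bigr (fun u => \sum_(i < #|O|) \sum_v
    (adj E u v)%:R * ((h i - h i.+1) ^+ 2 * (cross u v i)%:R))); last first.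
  by move=> u _; rewrite exchange_big; apply: eq_bigr => v _; rewrite mulr_sumr.
rewrite exchange_big mulr_sumr /=; apply: ler_sum => i _.
have [u [v [uv ui vi]]] : exists u v,
    [/\ adj E u v, (rk u <= i)%N & ~~ (rk v <= i)%N].
  apply: (@crossing_edge _ E (fun v => rk v <= i)%N (nth w s i) w) => //.
    by rewrite /rk index_uniq ?ss.
  by rewrite -ltnNge /rk memNindex ?ms // ss.
have term0 a b : 0 <= (adj E a b)%:R * ((h i - h i.+1) ^+ 2 * (cross a b i)%:R).
  by rewrite mulr_ge0 // mulr_ge0 ?sqr_ge0.
have vu : v != u by apply: contraNneq vi => ->.
have cuv : cross u v i by rewrite /cross ui ltnNge vi.
have cvu : cross v u i by rewrite /cross orbC.
have tuv : (h i - h i.+1) ^+ 2 <=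
    \sum_b (adj E u b)%:R * ((h i - h i.+1) ^+ 2 * (cross u b i)%:R).
  rewrite (bigD1 v) //= uv cuv mul1r mulr1 lerDl.
  by rewrite sumr_ge0.
have tvu : (h i - h i.+1) ^+ 2 <=
    \sum_b (adj E v b)%:R * ((h i - h i.+1) ^+ 2 * (cross v b i)%:R).
  rewrite (bigD1 u) //= adjC uv cvu mul1r mulr1 lerDl.
  by rewrite sumr_ge0.
rewrite (bigD1 u) //= [X in _ <= _ + X](bigD1 v) //= addrA mulr_natl mulr2n.
rewrite -[leLHS]addr0 lerD ?lerD // sumr_ge0 // => a _.
by rewrite sumr_ge0.
Qed.

End Rearrangement.

(** * Long branches and eigenfunctions *)

Section Branch.
Variables (R : realFieldType) (T : finType) (E : {set {set T}}).
Hypotheses (sE : simple_edges E) (aE : acyclic E).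
Hypothesis cE : forall x y, connect (adj E) x y.
Variables (mu : R) (Y : T -> R).
Hypotheses (mu_gt0 : 0 < mu).
Hypothesis mu_min : forall f : T -> R,
  \sum_v f v = 0 -> 2 * (mu * \sum_v f v ^+ 2) <= energy E f.
Hypothesis Y_eigen : forall u, lap E Y u = mu * Y u.

(** Truncating [Y] to its positive part on [O] shrinks its differences without
    changing their signs; across the boundary of [O] this holds because [Y] is
    nonpositive outside.  So the energy of the truncation is at most its pairing
    with the Laplacian of [Y]. *)
Lemma energy_pos_part (O : {set T}) (f : T -> R) :
  (forall u v, adj E u v -> u \in O -> v \notin O -> Y v <= 0) ->
  f =1 (fun v => if v \in O then Num.max (Y v) 0 else 0) ->
  energy E f <= 2 * (mu * \sum_v f v ^+ 2).
Proof.
move=> bdry fE.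
have pw u v : (adj E u v)%:R * (f u - f v) ^+ 2 <=
    (adj E u v)%:R * ((f u - f v) * (Y u - Y v)).
  have [uv|_] := boolP (adj E u v); last by rewrite !mul0r.
  have vu : adj E v u by rewrite adjC.
  rewrite !mul1r !fE.
  have [uO|uO] := boolP (u \in O); have [vO|vO] := boolP (v \in O).
  - by case: (leP (Y u) 0); case: (leP (Y v) 0); nra.
  - by have := bdry _ _ uv uO vO; case: (leP (Y u) 0); nra.
  - by have := bdry _ _ vu vO uO; case: (leP (Y v) 0); nra.
  - by rewrite subrr expr0n mul0r.
apply: le_trans (_ : \sum_u \sum_v
    (adj E u v)%:R * ((f u - f v) * (Y u - Y v)) <= _).
  by apply: ler_sum => u _; apply: ler_sum => v _; exact: pw.
rewrite energyE le_eqVlt; apply/orP; left; apply/eqP; congr (2 * _).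
rewrite mulr_sumr; apply: eq_bigr => u _; rewrite Y_eigen fE.
case: ifP => _; last by rewrite mul0r expr0n mulr0.
by case: (leP (Y u) 0) => _; ring.
Qed.

(** The combination [z = a f - b g] that is orthogonal to the constants has no
    cross terms, neither in its energy nor in its norm.  If both functions had
    Rayleigh quotient at most [mu], that of [f] being smaller, then [z] would
    have a quotient below the minimum [mu]. *)
Lemma energy_gt_of_separated (f g : T -> R) :
  (forall v, 0 <= f v) -> (forall v, 0 <= g v) ->
  (exists v, 0 < g v) ->
  (forall u v, adj E u v -> (f u - f v) * (g u - g v) = 0) ->
  (forall v, f v * g v = 0) ->
  energy E f < 2 * (mu * \sum_v f v ^+ 2) ->
  2 * (mu * \sum_v g v ^+ 2) < energy E g.
Proof.
move=> f0 g0 [v0 gv0] nadj disj Ef.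
pose a := \sum_v g v; pose b := \sum_v f v.
have a_gt0 : 0 < a.
  by rewrite /a (bigD1 v0) //= ltr_wpDr // sumr_ge0.
have b_gt0 : 0 < b.
  rewrite lt_neqAle sumr_ge0 // andbT eq_sym; apply/negP => /eqP b0.
  have fz v : f v = 0.
    apply/eqP; rewrite eq_le f0 andbT -b0 /b (bigD1 v) //= lerDl.
    by rewrite sumr_ge0.
  move: Ef; rewrite /energy !big1 ?mulr0 ?ltxx // => u _.
    by rewrite fz expr0n.
  by rewrite big1 // => v _; rewrite !fz subrr expr0n mulr0.
pose z v := a * f v - b * g v.
have z0 : \sum_v z v = 0.
  by rewrite sumrB -!mulr_sumr -/a -/b; ring.
have Ez : energy E z = a ^+ 2 * energy E f + b ^+ 2 * energy E g.
  rewrite /energy !mulr_sumr -big_split; apply: eq_bigr => u _ /=.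
  rewrite !mulr_sumr -big_split; apply: eq_bigr => v _ /=.
  have [uv|_] := boolP (adj E u v); last by rewrite !mul0r !mulr0 addr0.
  rewrite !mul1r.
  have := nadj _ _ uv; rewrite /z => e.
  transitivity (a ^+ 2 * (f u - f v) ^+ 2 + b ^+ 2 * (g u - g v) ^+ 2
     - 2 * a * b * ((f u - f v) * (g u - g v))); first by ring.
  by rewrite e; ring.
have Sz : \sum_v z v ^+ 2 =
    a ^+ 2 * \sum_v f v ^+ 2 + b ^+ 2 * \sum_v g v ^+ 2.
  rewrite !mulr_sumr -big_split; apply: eq_bigr => u _ /=.
  transitivity (a ^+ 2 * f u ^+ 2 + b ^+ 2 * g u ^+ 2 - 2 * a * b * (f u * g u)).
    by rewrite /z; ring.
  by rewrite disj; ring.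
have := mu_min z0; rewrite Ez Sz => M.
have a2 : 0 < a ^+ 2 by rewrite exprn_gt0.
have b2 : 0 < b ^+ 2 by rewrite exprn_gt0.
rewrite -(ltr_pM2l b2); move: M; rewrite -(ltr_pM2l a2) in Ef; nra.
Qed.

(** With [q] the number of edges of the path and [O] the complement of the branch
    and of [x0], the inequality follows from [q <= #|O|], as the [q + 1] path
    vertices lie outside [O].  If [q] were larger, the values of the positive
    part of [Y] on [O], laid along the path, would have a Rayleigh quotient
    below [mu]. *)
Lemma branch_bound (x0 v0 : T) (s : seq T) :
  path (adj E) x0 s -> uniq (x0 :: s) -> Y x0 <= 0 ->
  v0 \notin side E x0 (nth x0 s 0) -> 0 < Y v0 -> (2 * size s < #|T|)%N.
Proof.
move=> pP uP Yx0 v0F Yv0.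
have [s0|ls] := posnP (size s).
  by rewrite s0; apply/card_gt0P; exists x0.
set F := side E x0 _ in v0F.
have e0 : adj E x0 (nth x0 s 0) := path_adj pP ls.
have x0F : x0 \notin F := tail_notin_side sE aE e0.
pose O : {set T} := ~: (x0 |: F)%SET.
have cO : (#|O| + #|F|.+1 = #|T|)%N.
  by rewrite -(cardsC (x0 |: F)%SET) cardsU1 x0F addnC add1n.
have cF : (size s <= #|F|)%N.
  have us : uniq s by case/andP: uP.
  rewrite -(card_uniqP us); apply: subset_leq_card; apply/fintype.subsetP => y ys.
  have li : (index y s < size s)%N by rewrite index_mem.
  have := mem_side_path sE aE pP uP (i := (index y s).+1) (j := 0) li ls.
  by rewrite /= nth_index.
rewrite ltnNge; apply/negP => le_s.
have lt_m : (#|O| < size s)%N.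
  by clear -cF le_s cO; lia.
have inO v : (v \in O) = (v != x0) && (v \notin F).
  by rewrite !inE negb_or.
have v0O : v0 \in O.
  by rewrite inO v0F andbT; apply: contraTneq Yv0 => ->; rewrite -leNgt.
have bdry u v : adj E u v -> u \in O -> v \notin O -> v = x0.
  move=> uv; rewrite !inO => /andP[ux uF]; rewrite negb_and !negbK => /predU1P[//|vF].
  have vu : adj E v u by rewrite adjC.
  by have [_ ] := side_boundary sE aE e0 vu vF uF; move/eqP; rewrite (negbTE ux).
pose g v := if v \in O then Num.max (Y v) 0 else 0.
have g0 v : 0 <= g v by rewrite /g; case: ifP => // _; rewrite le_max lexx orbT.
have gO v : v \notin O -> g v = 0 by rewrite /g => /negbTE ->.
have Eg : energy E g <= 2 * (mu * \sum_v g v ^+ 2).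
  by apply: energy_pos_part (fun=> erefl) => u v uv uO vO; rewrite (bdry u v).
have gv0 : 0 < g v0 by rewrite /g v0O lt_max Yv0.
have x0O : x0 \notin O by rewrite inO eqxx.
have [h [hm hz hS hmax hE]] := rearrangement cE g0 gO x0O.
set m := #|O| in lt_m hz hS hE.
(* the values of g in increasing order along the path, from H 0 = h m = 0;
   beyond index m the largest value h 0 is repeated *)
pose H i := h (m - i)%N.
have Hm : {homo H : i j / (i <= j)%N >-> i <= j}.
  by move=> i j ij; apply: hm; rewrite leq_sub2l.
have H0 : H 0%N = 0 by rewrite /H subn0 hz.
have [f [f0 fF fS fE]] := transplant sE aE pP uP H0 Hm.
have h0 : 0 < h 0%N by exact: lt_le_trans gv0 (hmax v0).
have Hgap : \sum_(i < size s) (H i.+1 - H i) ^+ 2 =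
    \sum_(i < m) (h i - h i.+1) ^+ 2.
  rewrite -(big_mkord xpredT (fun i => (H i.+1 - H i) ^+ 2)).
  have le_m := ltnW lt_m.
  rewrite (big_cat_nat (n := m)) //= [X in _ + X]big_nat_cond.
  rewrite [X in _ + X]big1 ?addr0; last first.
    move=> i; rewrite andbT => /andP[mi _]; rewrite /H.
    have /eqP -> : (m - i == 0)%N by rewrite subn_eq0.
    have /eqP -> : (m - i.+1 == 0)%N by rewrite subn_eq0 ltnW.
    by rewrite subrr expr0n.
  rewrite big_mkord (reindex_inj rev_ord_inj); apply: eq_bigr => i _ /=.
  by rewrite /H subnSK // !subKn // ltnW.
have fN : \sum_v g v ^+ 2 + h 0%N ^+ 2 <= \sum_v f v ^+ 2.
  apply: le_trans fS; rewrite -hS.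
  rewrite -(big_mkord xpredT (fun i => H i ^+ 2)).
  rewrite (big_cat_nat (n := m.+2)) //= -[leLHS]addr0 lerD //; last first.
    by apply: sumr_ge0 => i _; exact: sqr_ge0.
  rewrite big_mkord big_ord_recr /= {2}/H.
  have /eqP -> : (m - m.+1 == 0)%N by rewrite subn_eq0.
  rewrite lerD2r [leRHS](reindex_inj rev_ord_inj) /=.
  rewrite (eq_bigr (fun i : 'I_m.+1 => h i ^+ 2)); last first.
    by move=> i _; rewrite /H subSS subKn // -ltnS.
  by rewrite big_ord_recr /= lerDl sqr_ge0.
have Ef : energy E f < 2 * (mu * \sum_v f v ^+ 2).
  apply: le_lt_trans fE _; rewrite Hgap; apply: le_lt_trans hE _.
  apply: le_lt_trans Eg _; rewrite ltr_pM2l // ltr_pM2l //.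
  by apply: lt_le_trans fN; rewrite ltrDl exprn_gt0.
have fO v : v \in O -> f v = 0 by rewrite inO => /andP[_ /fF].
have dj v : f v * g v = 0.
  have [/fO ->|/gO ->] := boolP (v \in O); first by rewrite mul0r.
  by rewrite mulr0.
suff nadj u v : adj E u v -> (f u - f v) * (g u - g v) = 0.
  have := energy_gt_of_separated f0 g0 (ex_intro _ v0 gv0) nadj dj Ef.
  by rewrite ltNge Eg.
move=> uv; have vu : adj E v u by rewrite adjC.
have [uO|uO] := boolP (u \in O); have [vO|vO] := boolP (v \in O).
- by rewrite !fO // subrr mul0r.
- by rewrite (bdry _ _ uv uO vO) (fO u) // fF // subrr mul0r.
- by rewrite (bdry _ _ vu vO uO) (fO v) // fF // subrr mul0r.
- by rewrite !gO // subrr mulr0.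
Qed.

End Branch.

Section CharacteristicEccentricity.
Variables (R : realFieldType) (T : finType) (E : {set {set T}}).
Hypotheses (sE : simple_edges E) (aE : acyclic E).
Hypothesis cE : forall x y, connect (adj E) x y.
Variables (mu : R) (Y : T -> R).
Hypotheses (mu_gt0 : 0 < mu).
Hypothesis mu_min : forall f : T -> R,
  \sum_v f v = 0 -> 2 * (mu * \sum_v f v ^+ 2) <= energy E f.
Hypothesis Y_eigen : forall u, lap E Y u = mu * Y u.

Lemma branch_bound_signed (x0 v0 : T) (s : seq T) :
  path (adj E) x0 s -> uniq (x0 :: s) -> v0 \notin side E x0 (nth x0 s 0) ->
  Y x0 * Y v0 <= 0 -> Y v0 != 0 -> (2 * size s < #|T|)%N.
Proof.
move=> pP uP v0F le0 nz.
have [gt0|le] := ltP 0 (Y v0).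
  apply: (branch_bound sE aE cE mu_gt0 mu_min Y_eigen pP uP _ v0F gt0).
  by move: le0; rewrite pmulr_lle0.
have lt0 : Y v0 < 0 by rewrite lt_neqAle nz.
apply: (@branch_bound _ _ _ sE aE cE mu (fun v => - Y v) mu_gt0 mu_min _ _ _ _
  pP uP _ v0F); last by rewrite oppr_gt0.
  move=> u; rewrite mulrN -Y_eigen /lap -sumrN; apply: eq_bigr => v _; ring.
by rewrite oppr_le0; move: le0; rewrite nmulr_lle0.
Qed.

(** If [Y] vanishes at [x], the eigenvalue equation at [x] gives a neighbour
    outside the branch of the path where [Y] is not zero, and the branch bound
    applies at [x].  If [Y] changes sign along an edge [xu], it applies at [x]
    when the path avoids [u], with [u] as the vertex of the other sign, and
    otherwise at [u], with [x] in that role and one edge less of path; this lost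
    edge is why the bound is [#|T|.+1]. *)
Lemma char_vertex_path_bound (x : T) (s : seq T) :
  (Y x = 0 /\ exists2 u, adj E x u & Y u != 0) \/
  (exists2 u, adj E x u & Y x * Y u < 0) ->
  path (adj E) x s -> uniq (x :: s) -> (2 * size s <= #|T|.+1)%N.
Proof.
move=> cx pP uP.
case: (posnP (size s)) => [->|ls]; first by rewrite muln0.
pose y := nth x s 0.
have xy : adj E x y := path_adj pP ls.
have xF : x \notin side E x y := tail_notin_side sE aE xy.
have nbr_out u : adj E x u -> u != y -> u \notin side E x y.
  rewrite adjC => ux; apply: contraNN => uF.
  by have [-> _] := side_boundary sE aE xy ux uF xF.
case: cx => [[Yx [u xu Yu]]|[u xu Yxu]].
  suff /existsP[v /and3P[xv vy Yv]] :
      [exists v, [&& adj E x v, v != y & Y v != 0]].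
    have vF := nbr_out v xv vy.
    have := branch_bound_signed pP uP vF _ Yv.
    by rewrite Yx mul0r lexx => /(_ isT)/ltnW/leqW.
  apply: contraT => /existsPn no.
  have Yv0 v : adj E x v -> v != y -> Y v = 0.
    by move=> xv vy; apply/eqP; have := no v; rewrite xv vy /= negbK.
  have uy : u = y by apply: contraNeq Yu => /(Yv0 _ xu) ->.
  have := Y_eigen x; rewrite Yx mulr0 /lap (bigD1 y) //= big1; last first.
    move=> v vy; have [xv|_] := boolP (adj E x v); last by rewrite mul0r.
    by rewrite Yx Yv0 // subrr mulr0.
  rewrite xy Yx mul1r sub0r addr0 => /eqP; rewrite oppr_eq0 -uy.
  by rewrite (negbTE Yu).
have Yu : Y u != 0 by apply: contraTneq Yxu => ->; rewrite mulr0 ltxx.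
have Yx : Y x != 0 by apply: contraTneq Yxu => ->; rewrite mul0r ltxx.
have [uy|uy] := eqVneq u y; last first.
  have := branch_bound_signed pP uP (nbr_out u xu uy) (ltW Yxu) Yu.
  by move/ltnW/leqW.
(* the path leaves x through u: the branch starts at u and avoids x *)
case: s pP uP ls @y xy xF nbr_out uy => [//|z s] pP uP _ y xy xF _ uy.
rewrite /y /= in uy; rewrite -uy in pP uP xu.
move: pP uP => /= /andP[_ pP] /andP[xus uP].
have bound : (2 * size s < #|T|)%N.
  case: (posnP (size s)) => [->|ls]; first by apply/card_gt0P; exists x.
  apply: (branch_bound_signed (v0 := x) pP uP) => //.
    have uw := path_adj pP ls.
    have uF := tail_notin_side sE aE uw.
    apply: contraNN xus => xs.
    have [-> _] := side_boundary sE aE uw xu xs uF.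
    by rewrite /= in_cons mem_nth ?orbT.
  by rewrite mulrC ltW.
by rewrite /= mulnS add2n ltnS.
Qed.

End CharacteristicEccentricity.

(** * Algebraic connectivity as a minimum of Rayleigh quotients *)

Section Spectral.
Local Open Scope sesquilinear_scope.

Lemma char_poly_similar (F : fieldType) n (P A : 'M[F]_n) :
  P \in unitmx -> char_poly (invmx P *m A *m P) = char_poly A.
Proof.
move=> uP.
have uPC : map_mx (@polyC F) P \in unitmx by rewrite map_unitmx.
have E : char_poly_mx (invmx P *m A *m P) =
   invmx (map_mx (@polyC F) P) *m char_poly_mx A *m map_mx (@polyC F) P.
  rewrite /char_poly_mx mulmxBr mulmxBl !map_mxM /= map_invmx.
  rewrite mul_mx_scalar -scalemxAl mulVmx ?scalemx1 //.
by rewrite /char_poly E !det_mulmx det_inv mulrAC mulVr ?mul1r // -unitmxE.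
Qed.

(** A real symmetric matrix is normal over [R[i]], hence unitarily diagonalisable,
    with real eigenvalues.  The unitary matrix may stay complex, since it only
    serves to bound real quadratic forms and to count eigenvalues. *)
Lemma real_spectral (R : realType) n (A : 'M[R]_n) : A^T = A ->
  exists P : 'M[R[i]]_n, exists d : 'I_n -> R,
  [/\ P *m P^t* = 1%:M,
      map_mx (real_complex R) A =
        P^t* *m diag_mx (\row_i real_complex R (d i)) *m P
    & char_poly A = \prod_(i < n) ('X - (d i)%:P)].
Proof.
move=> sA; pose AC := map_mx (real_complex R) A.
have rA : AC \is a mxOver Num.real.
  by apply/mxOverP => i j; rewrite mxE complex_real.
have symA : AC \is symmetricmx.
  by apply/is_hermitianmxP; rewrite expr0 scale1r map_mx_id // map_trmx sA.
pose P := spectralmx AC; pose D := spectral_diag AC.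
have uP : P \is unitarymx := spectral_unitarymx AC.
have rD : D \is a mxOver Num.real.
  exact/hermitian_spectral_diag_real/realsym_hermsym.
pose d i := complex.Re (D 0 i).
have DE : D = \row_i real_complex R (d i).
  apply/rowP => i; rewrite mxE /d.
  by have /mxOverP/(_ 0 i)/complex_realP[k ->] := rD.
have AE : AC = P^t* *m diag_mx D *m P.
  rewrite -invmx_unitary //; exact/orthomx_spectralP/symmetric_normalmx.
exists P, d; split; [exact/unitarymxP | by rewrite -DE | ].
apply: (map_poly_inj (real_complex R)); rewrite map_char_poly -/AC.
rewrite AE -invmx_unitary // char_poly_similar ?unitarymx_unit //.
rewrite char_poly_trig ?diag_mx_is_trig // rmorph_prod.
apply: eq_bigr => i _; rewrite rmorphB /= map_polyX map_polyC DE !mxE eqxx mulr1n //.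
Qed.

End Spectral.

Section AlgebraicConnectivity.
Variables (R : realType) (n : nat) (E : {set {set 'I_n}}).
Local Open Scope sesquilinear_scope.

Lemma laplacianE (Y : 'cV[R]_n) u :
  (laplacian R E *m Y) u 0 = lap E (fun v => Y v 0) u.
Proof.
rewrite /laplacian /degree_mx mulmxBl mul_diag_mx !mxE /lap.
rewrite (eq_bigr (fun v => (adj E u v)%:R * Y v 0)); last by move=> v _; rewrite mxE.
under [RHS]eq_bigr => v _ do rewrite mulrBr.
rewrite sumrB; congr (_ - _); rewrite -mulr_suml; congr (_ * _).
rewrite -sum1_card natr_sum big_mkcond /=; apply: eq_bigr => v _.
by rewrite inE; case: (adj E u v).
Qed.

Lemma laplacian_sym : (laplacian R E)^T = laplacian R E.
Proof.
apply/matrixP => i j; rewrite !mxE adjC; congr (_ - _).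
by rewrite eq_sym; case: eqVneq => [->|].
Qed.

Lemma laplacian_quad (f : 'I_n -> R) :
  2 * ((\row_i f i) *m laplacian R E *m (\row_i f i)^T) 0 0 = energy E f.
Proof.
rewrite -mulmxA mxE /energy.
under [RHS]eq_bigr => u _ do under eq_bigr => v _ do rewrite expr2.
rewrite energyE; congr (2 * _); apply: eq_bigr => u _.
rewrite mxE laplacianE; congr (_ * _); apply: eq_bigr => v _.
by rewrite !mxE.
Qed.

Hypothesis cE : forall x y, connect (adj E) x y.

Lemma energy_ge0 (f : 'I_n -> R) : 0 <= energy E f.
Proof.
by apply: sumr_ge0 => u _; apply: sumr_ge0 => v _; rewrite mulr_ge0 ?sqr_ge0.
Qed.

(** Connectedness makes the eigenvalue 0 of the Laplacian simple. *)
Lemma energy_eq0_const (f : 'I_n -> R) : energy E f = 0 -> forall u v, f u = f v.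
Proof.
move=> e0 u v; apply/eqP; rewrite eq_sym.
apply: (connect_ind (a := fun w => f w == f u) (eqxx _)) (cE u v) => x y /eqP <- xy.
have h a b : 0 <= (adj E a b)%:R * (f a - f b) ^+ 2.
  by rewrite mulr_ge0 ?sqr_ge0.
move: e0; rewrite /energy => /eqP; rewrite psumr_eq0; last first.
  by move=> a _; apply: sumr_ge0.
move=> /allP/(_ x (mem_index_enum _)) /=; rewrite psumr_eq0 // => /allP.
move=> /(_ y (mem_index_enum _)) /=.
by rewrite xy mul1r sqrf_eq0 subr_eq0 eq_sym.
Qed.

Lemma laplacian_quad_row (x : 'rV[R]_n) :
  2 * (x *m laplacian R E *m x^T) 0 0 = energy E (x 0).
Proof.
rewrite -laplacian_quad; congr (2 * (_ *m _ *m _^T) 0 0).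
  by apply/rowP => i; rewrite mxE.
by apply/rowP => i; rewrite mxE.
Qed.

Lemma laplacian_eigenvalue_ge0 a : eigenvalue (laplacian R E) a -> 0 <= a.
Proof.
case/eigenvalueP => v va v0.
have N : 0 < (v *m v^T) 0 0.
  rewrite mxE; under eq_bigr => i _ do rewrite mxE -expr2.
  rewrite lt_neqAle sumr_ge0 ?andbT; last by move=> i _; exact: sqr_ge0.
  apply: contraNneq v0 => /esym/eqP; rewrite psumr_eq0; last first.
    by move=> i _; exact: sqr_ge0.
  move=> /allP h; apply/eqP/rowP => i; rewrite mxE; apply/eqP.
  by have := h i (mem_index_enum _); rewrite /= sqrf_eq0.
have := energy_ge0 (v 0); rewrite -laplacian_quad_row va -scalemxAl mxE.
by rewrite pmulr_rge0 // pmulr_lge0.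
Qed.

Lemma laplacian_ones : const_mx 1 *m laplacian R E = 0 :> 'rV[R]_n.
Proof.
apply: trmx_inj; rewrite trmx_mul laplacian_sym trmx0; apply/colP => i.
rewrite laplacianE mxE /lap big1 // => j _.
by rewrite !mxE subrr mulr0.
Qed.

Lemma laplacian_ker : (kermx (laplacian R E) <= (const_mx 1 : 'rV_n))%MS.
Proof.
apply/row_subP => i; set x := row i _.
have xL : x *m laplacian R E = 0.
  by rewrite /x -row_mul mulmx_ker row0.
have : energy E (x 0) = 0 by rewrite -laplacian_quad_row xL mul0mx mxE mulr0.
move=> /energy_eq0_const xc; apply/sub_rVP; exists (x 0 i).
by apply/rowP => j; rewrite [RHS]mxE [const_mx _ _ _]mxE mulr1; exact: xc.
Qed.

(** All that is used of the position of the algebraic connectivity in the sorted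
    spectrum. *)
Lemma sorted_second (s : seq R) : sorted <=%R s -> (2 <= size s)%N ->
  (count (fun z => (z < s`_1)%R) s <= 1)%N /\ (2 <= count (fun z => (z <= s`_1)%R) s)%N.
Proof.
case: s => [|a [|b s]] //= /andP[ab bs] _; split; last by rewrite ab lexx.
rewrite ltxx add0n (_ : count _ s = 0%N) ?addn0 ?leq_b1 //.
apply/eqP; rewrite -leqn0 leqNgt -has_count -all_predC.
apply/allP => z zs /=; rewrite -leNgt.
by have /(order_path_min le_trans)/allP := bs; exact.
Qed.

Local Notation L := (laplacian R E).
Local Notation mu := (alg_connectivity R E).

Section Diagonalised.
Variables (P : 'M[R[i]]_n) (d : 'I_n -> R).
Hypothesis uP : P *m P^t* = 1%:M.
Hypothesis LP : map_mx (real_complex R) L =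
  P^t* *m diag_mx (\row_i real_complex R (d i)) *m P.
Local Notation C := (map_mx (real_complex R)).

Let uP' : P^t* *m P = 1%:M. Proof. exact: mulmx1C. Qed.

(** Coordinates of a real vector in the unitary eigenbasis given by the rows of
    [P]. *)
Definition coords (x : 'rV[R]_n) : 'rV[R[i]]_n := C x *m P^t*.

Lemma real_conj (x : 'rV[R]_n) : (C x)^t* = (C x)^T.
Proof.
by apply/colP => i; rewrite !mxE; apply/CrealP; rewrite complex_real.
Qed.

Lemma coordsE (x : 'rV[R]_n) : P *m C x^T = (coords x)^t*.
Proof.
by rewrite /coords trmx_mul map_mxM /= real_conj trmxCK map_trmx.
Qed.

Lemma coords_dot (x y : 'rV[R]_n) :
  real_complex R ((x *m y^T) 0 0) = \sum_i coords x 0 i * (coords y 0 i)^*.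
Proof.
have -> : real_complex R ((x *m y^T) 0 0) = (C (x *m y^T)) 0 0 by rewrite [RHS]mxE.
rewrite map_mxM /= -[C x]mulmx1 -uP' mulmxA -mulmxA coordsE -/(coords x) mxE.
by apply: eq_bigr => i _; rewrite !mxE.
Qed.

Lemma coords_quad (x y : 'rV[R]_n) :
  real_complex R ((x *m L *m y^T) 0 0) =
  \sum_i real_complex R (d i) * (coords x 0 i * (coords y 0 i)^*).
Proof.
have -> : real_complex R ((x *m L *m y^T) 0 0) = (C (x *m L *m y^T)) 0 0.
  by rewrite [RHS]mxE.
rewrite !map_mxM /= LP -!mulmxA coordsE !mulmxA -/(coords x) mxE.
apply: eq_bigr => i _; rewrite mul_mx_diag !mxE.
by rewrite -mulrA mulrCA.
Qed.

Lemma row_eigen i : row i P *m C L = real_complex R (d i) *: row i P.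
Proof.
rewrite LP -row_mul !mulmxA uP mul1mx mul_diag_mx; apply/rowP => j.
by rewrite !mxE.
Qed.

(** Two rows of [P] of eigenvalue 0 are constant vectors, and nonzero constant
    vectors are not orthogonal. *)
Lemma kernel_index_unique i j : d i = 0 -> d j = 0 -> i = j.
Proof.
have const k : d k = 0 -> exists a, forall l, P k l = a.
  move=> dk.
  have : (row k P <= kermx (C L))%MS.
    by apply/sub_kermxP; rewrite row_eigen dk rmorph0 scale0r.
  rewrite -map_kermx => /submx_trans/(_ _).
  have : (C (kermx L) <= C (const_mx 1 : 'rV_n))%MS by rewrite map_submx laplacian_ker.
  move=> h /(_ _ _ h)/sub_rVP[a aE]; exists a => l.
  have := congr1 (fun A : 'rV[_]_n => A 0 l) aE.
  by rewrite !mxE rmorph1 mulr1.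
move=> /const[a aE] /const[b bE].
have dot k l x y : (forall m, P k m = x) -> (forall m, P l m = y) ->
    (k == l)%:R = n%:R * (x * y^*).
  move=> kx ly; have := congr1 (fun A : 'M[_]_n => A k l) uP; rewrite !mxE => <-.
  rewrite (eq_bigr (fun=> x * y^*)); last by move=> m _; rewrite !mxE kx ly.
  by rewrite sumr_const card_ord mulr_natl.
have aa := dot _ _ _ _ aE aE; have bb := dot _ _ _ _ bE bE.
have ab := dot _ _ _ _ aE bE; rewrite !eqxx in aa bb.
apply/eqP; apply: contraTT isT => /negbTE ij; rewrite ij in ab.
have /eqP := ab; rewrite eq_sym !mulf_eq0 conjC_eq0 => /or3P[] /eqP z.
- by move/eqP: aa; rewrite z mul0r oner_eq0.
- by move/eqP: aa; rewrite z mul0r mulr0 oner_eq0.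
- by move/eqP: bb; rewrite z mul0r mulr0 oner_eq0.
Qed.

Definition weight (x : 'rV[R]_n) i : R :=
  complex.Re (coords x 0 i) ^+ 2 + complex.Im (coords x 0 i) ^+ 2.

Lemma weightE x i :
  coords x 0 i * (coords x 0 i)^* = real_complex R (weight x i).
Proof.
rewrite /weight; case: (coords x 0 i) => a b /=.
by apply/eqP; rewrite eq_complex /=; apply/andP; split; apply/eqP; ring.
Qed.

(** If only one eigenvalue is below [m], it is the eigenvalue 0 of the constants.
    A vector orthogonal to the constants has no component on that axis, and all
    the other eigenvalues are at least [m]. *)
Lemma rayleigh_bound (m : R) (f : 'I_n -> R) : 0 < m -> (0 < n)%N ->
  (forall i j, d i < m -> d j < m -> i = j) ->
  \sum_v f v = 0 -> 2 * (m * \sum_v f v ^+ 2) <= energy E f.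
Proof.
move=> m0 n0 uniq_lt sf0; pose x : 'rV[R]_n := \row_i f i.
pose e : 'rV[R]_n := const_mx 1.
have xx : \sum_v f v ^+ 2 = \sum_i weight x i.
  apply: (@complexI R); transitivity (real_complex R ((x *m x^T) 0 0)).
    by congr (real_complex R _); rewrite mxE; apply: eq_bigr => v _; rewrite !mxE.
  rewrite coords_dot rmorph_sum; apply: eq_bigr => i _; exact: weightE.
have xLx : (x *m L *m x^T) 0 0 = \sum_i d i * weight x i.
  apply: (@complexI R); rewrite coords_quad rmorph_sum.
  by apply: eq_bigr => i _; rewrite weightE rmorphM.
rewrite -laplacian_quad -/x xLx xx ler_pM2l // mulr_sumr.
(* the constant vector lies on the only axis of eigenvalue below m *)
have ce i : coords e 0 i != 0 -> d i = 0.
  have h : coords e *m diag_mx (\row_i real_complex R (d i)) = 0.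
    have : C (e *m L) = 0 by rewrite laplacian_ones map_mx0.
    rewrite map_mxM LP !mulmxA => /(congr1 (mulmx^~ (P^t*))).
    by rewrite /= -[LHS]mulmxA uP mulmx1 mul0mx.
  have := congr1 (fun A : 'rV[_]_n => A 0 i) h; rewrite mul_mx_diag !mxE => /eqP.
  by rewrite mulf_eq0 => /orP[-> //|/eqP/complexI].
have [i0 ce0] : exists i0, coords e 0 i0 != 0.
  apply/existsP; apply: contraT => /existsPn no.
  have : C e = 0.
    rewrite -[C e]mulmx1 -uP' mulmxA -/(coords e).
    suff -> : coords e = 0 by rewrite mul0mx.
    by apply/rowP => i; rewrite [RHS]mxE; apply/eqP; have := no i; rewrite negbK.
  move/(congr1 (fun A : 'rV[_]_n => A 0 (Ordinal n0))); rewrite !mxE => /eqP.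
  by rewrite rmorph1 oner_eq0.
have d0 := ce _ ce0.
have di i : i != i0 -> m <= d i.
  by move=> ii0; rewrite leNgt; apply: contra ii0 => lt; apply/eqP/uniq_lt; rewrite ?d0.
have x0 : coords x 0 i0 = 0.
  have : real_complex R ((x *m e^T) 0 0) = 0.
    rewrite mxE (_ : \sum__ _ = 0) ?rmorph0 // -[RHS]sf0.
    by apply: eq_bigr => v _; rewrite !mxE mulr1.
  rewrite coords_dot (bigD1 i0) //= big1 => [/eqP|i ii0].
    by rewrite addr0 mulf_eq0 conjC_eq0 (negbTE ce0) orbF => /eqP.
  have [->|/ce di0] := eqVneq (coords e 0 i) 0; first by rewrite conjC0 mulr0.
  by have := di i ii0; rewrite di0 leNgt m0.
apply: ler_sum => i _; have [->|/di le] := eqVneq i i0.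
  by rewrite /weight x0 /= !expr0n /= addr0 !mulr0.
by rewrite ler_wpM2r // addr_ge0 ?sqr_ge0.
Qed.

End Diagonalised.

Hypothesis n_ge2 : (2 <= n)%N.

(** The algebraic connectivity is positive because 0 is a simple eigenvalue, and
    it bounds the Rayleigh quotients from below because at most one eigenvalue
    is smaller.  The factor 2 comes from the normalisation of [energy]. *)
Lemma alg_connectivity_spec :
  [/\ 0 < mu,
      forall f : 'I_n -> R,
        \sum_v f v = 0 -> 2 * (mu * \sum_v f v ^+ 2) <= energy E f
    & exists Y : 'cV[R]_n, fiedler_vector E Y].
Proof.
have [P [d [uP LP cP]]] := real_spectral laplacian_sym.
pose t := map d (enum 'I_n).
have ct : char_poly L = \prod_(z <- t) ('X - z%:P) by rewrite big_map big_enum.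
have [so cs] : sorted <=%R (spectrum L) /\
    char_poly L = \prod_(z <- spectrum L) ('X - z%:P).
  apply: (@xgetPex _ [::] (fun s => sorted <=%R s /\
    char_poly L = \prod_(z <- s) ('X - z%:P))).
  exists (sort <=%R t); split; first exact: (sort_sorted le_total).
  by rewrite ct; apply: perm_big; rewrite perm_sym perm_sort.
have st : perm_eq (spectrum L) t by apply: prod_XsubC_eq; rewrite -cs.
have sz : size (spectrum L) = n by rewrite (perm_size st) size_map size_enum_ord.
have [c1 c2] := sorted_second so (leq_trans n_ge2 (eq_leq (esym sz))).
rewrite -/mu (permP st) count_map in c1.
rewrite -/mu (permP st) count_map in c2.
have muE : eigenvalue L mu.
  rewrite eigenvalue_root_char cs root_prod_XsubC mem_nth //.
  by rewrite sz.
have mu_ge0 := laplacian_eigenvalue_ge0 muE.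
have dE i : eigenvalue L (d i).
  by rewrite eigenvalue_root_char ct root_prod_XsubC map_f ?mem_enum.
have ddE (p : pred 'I_n) : count p (enum 'I_n) = #|p|.
  by rewrite -size_filter cardE; congr size; rewrite enumT.
rewrite !ddE in c1 c2.
have mu_gt0 : 0 < mu.
  rewrite lt_neqAle mu_ge0 andbT; apply: contraTneq c2 => mu0.
  rewrite -ltnNge ltnS; apply/card_le1_eqP => i j; rewrite !inE -mu0 => di dj.
  apply: (kernel_index_unique uP LP); apply/eqP; rewrite eq_le ?di ?dj /=.
    exact/laplacian_eigenvalue_ge0/dE.
  exact/laplacian_eigenvalue_ge0/dE.
split=> //.
  move=> f; apply: (rayleigh_bound uP LP mu_gt0); first exact: ltnW.
  by move=> i j di dj; move/card_le1_eqP: c1; apply; rewrite inE.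
case/eigenvalueP: muE => v vL v0; exists v^T; split.
  by apply: contraNneq v0 => /(congr1 trmx); rewrite trmxK trmx0 => ->.
by rewrite -[L]laplacian_sym -trmx_mul vL linearZ.
Qed.

Lemma fiedler_eigen (Y : 'cV[R]_n) : fiedler_vector E Y ->
  forall u, lap E (fun v => Y v 0) u = mu * Y u 0.
Proof. by case=> _ LY u; rewrite -laplacianE LY mxE. Qed.

End AlgebraicConnectivity.

(** * Distances in a tree and the characteristic center *)

Section TreeDistance.
Variables (T : finType) (E : {set {set T}}).
Hypothesis cE : forall x y, connect (adj E) x y.

Lemma tree_pathP x y : let p := tree_path E x y in
  [/\ path (adj E) x p, uniq (x :: p) & last x p = y].
Proof.
apply: (@xgetPex _ [::] (fun p =>
  [/\ path (adj E) x p, uniq (x :: p) & last x p = y])).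
have /connectP[p0 p0P p0y] := cE x y.
by case/shortenP: p0P p0y => p pP up _ py; exists p.
Qed.

(** Along a path, the height [pos] changes by at most one at each step. *)
Lemma tree_dist_lipschitz (pos : T -> nat) :
  (forall u v, adj E u v -> (pos v <= (pos u).+1)%N) ->
  forall x y, (pos y <= pos x + tree_dist E x y)%N /\
              (pos x <= pos y + tree_dist E x y)%N.
Proof.
move=> lip x y; rewrite /tree_dist.
have [] := tree_pathP x y; move: (tree_path E x y) => p.
elim: p x => [|z p IH] x /= => [_ _ <-|]; first by rewrite addn0.
case/andP => xz zp /andP[_ up] py; have [le1 le2] := IH z zp up py.
have zx : adj E z x by rewrite adjC.
have lxz := lip _ _ xz; have lzx := lip _ _ zx.
by move: le1 le2 lxz lzx; clear; lia.
Qed.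

Lemma bigminn_le (I : eqType) (r : seq I) (P : pred I) (F : I -> nat) d i :
  i \in r -> P i -> (\big[minn/d]_(j <- r | P j) F j <= F i)%N.
Proof.
elim: r => // a r IH; rewrite inE big_cons => /predU1P[<- ->|ir Pi].
  exact: geq_minl.
by case: ifP => _; [rewrite (leq_trans (geq_minr _ _)) //|]; exact: IH.
Qed.

Lemma bigminn_ge (I : Type) (r : seq I) (P : pred I) (F : I -> nat) d b :
  (b <= d)%N -> (forall i, P i -> (b <= F i)%N) ->
  (b <= \big[minn/d]_(j <- r | P j) F j)%N.
Proof.
by move=> bd bF; elim/big_ind: _ => // x y bx by_; rewrite leq_min bx.
Qed.

Lemma set_dist_le (X Y : {set T}) x y : x \in X -> y \in Y ->
  (set_dist E X Y <= tree_dist E x y)%N.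
Proof.
move=> xX yY; rewrite /set_dist.
apply: leq_trans (bigminn_le _ _ (mem_index_enum x) xX) _.
exact: bigminn_le (mem_index_enum y) yY.
Qed.

Lemma core_center_nonempty (x : T) : exists y, y \in core_center E.
Proof.
exists [arg max_(y > x) ecc_subtree E y].
by case: arg_maxnP => // y _ yM; rewrite inE; apply/forallP => z; exact: yM.
Qed.

End TreeDistance.

Lemma is_tree_connected (T : finType) (E : {set {set T}}) : is_tree E ->
  forall x y, connect (adj E) x y.
Proof.
case=> _ /andP[_ /forall_inP h] _ x y.
by have /forall_inP := h x (finset.in_setT _); apply; exact: finset.in_setT.
Qed.

Section CharCenter.
Variables (R : realType) (n : nat) (E : {set {set 'I_n}}).
Hypotheses (tE : is_tree E) (n_ge2 : (2 <= n)%N).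

(** The bound that drives both halves of the theorem. *)
Lemma char_center_dist x y : x \in char_center R E ->
  (2 * tree_dist E x y <= n.+1)%N.
Proof.
have [sE _ aE] := tE; have cE := is_tree_connected tE.
rewrite inE => /asboolP[Y fY cY].
have [mu0 mu_min _] := alg_connectivity_spec R cE n_ge2.
have [pP uP _] := tree_pathP cE x y.
have := char_vertex_path_bound sE aE cE mu0 mu_min (fiedler_eigen fY) cY pP uP.
by rewrite card_ord.
Qed.

(** A Fiedler vector is orthogonal to the constants, so it is positive somewhere
    and nonpositive somewhere else; an edge between these two regions has a
    characteristic vertex as an end. *)
Lemma char_center_nonempty : exists x, x \in char_center R E.
Proof.
have [sE _ aE] := tE; have cE := is_tree_connected tE.
have [mu0 _ [Y fY]] := alg_connectivity_spec R cE n_ge2.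
suff [x cx] : exists x, char_vertex E Y x.
  by exists x; rewrite inE; apply/asboolP; exists Y.
have sY : \sum_u Y u 0 = 0.
  have := energyE E (fun=> 1 : R) (fun v => Y v 0).
  rewrite big1 => [|u _]; last by rewrite big1 // => v _; rewrite subrr mul0r mulr0.
  under eq_bigr => u _ do rewrite mul1r (fiedler_eigen fY).
  rewrite -mulr_sumr => /eqP; rewrite eq_sym !mulf_eq0 pnatr_eq0 /= gt_eqF //=.
  by move/eqP.
have [u Yu] : exists u, 0 < Y u 0.
  apply/existsP; apply: contraT => /existsPn no.
  case: fY => /negP[]; apply/eqP/colP => u; rewrite mxE.
  have : \sum_u - Y u 0 == 0 by rewrite sumrN sY oppr0.
  rewrite psumr_eq0 => [/allP/(_ u (mem_index_enum _))|v _].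
    by rewrite /= oppr_eq0 => /eqP.
  by rewrite oppr_ge0 leNgt no.
have [w Yw] : exists w, Y w 0 <= 0.
  apply/existsP; apply: contraT => /existsPn no.
  have : 0 < \sum_u Y u 0; last by rewrite sY ltxx.
  rewrite (bigD1 u) //= ltr_pwDl // sumr_ge0 // => v _.
  by rewrite ltW // ltNge no.
have [|a [b [ab Ya]]] := @crossing_edge _ E (fun v => 0 < Y v 0) u w (cE u w) Yu.
  by rewrite -leNgt.
rewrite -leNgt le_eqVlt => /orP[/eqP Yb|Yb].
  by exists b; left; split=> //; exists a; rewrite ?gt_eqF // adjC.
by exists a; right; exists b => //; rewrite pmulr_rlt0.
Qed.

End CharCenter.

(** * Subtrees of a tree as vertex sets *)

Section InducedSubtrees.
Variables (T : finType) (E : {set {set T}}).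

Definition induced (S : {set T}) : {set {set T}} := [set A in E | A \subset S]%SET.

Lemma induced_subgraph S : is_subgraph E (S, induced S).
Proof.
apply/andP; split; first by apply/fintype.subsetP => A; rewrite inE => /andP[].
by apply/forall_inP => A; rewrite inE => /andP[].
Qed.

Lemma subgraph_sub (H : {set T} * {set {set T}}) u v : is_subgraph E H ->
  adj H.2 u v -> [/\ adj E u v, u \in H.1 & v \in H.1].
Proof.
case/andP => /fintype.subsetP HE /forall_inP Hs uv.
have /fintype.subsetP uvs := Hs _ uv.
by split; [exact: HE | apply: uvs; exact: finset.set21 | apply: uvs; exact: finset.set22].
Qed.

Lemma adj_sub (F F' : {set {set T}}) : F \subset F' -> subrel (adj F) (adj F').
Proof. by move=> /fintype.subsetP s u v; exact: s. Qed.

(** An edge of the tree between two vertices of a subtree belongs to the subtree,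
    as it is a bridge.  Subtrees are thus determined by their vertex sets. *)
Lemma subtree_induced (H : {set T} * {set {set T}}) :
  simple_edges E -> acyclic E -> is_subgraph E H -> connected_graph H.1 H.2 ->
  H.2 = induced H.1.
Proof.
move=> sE aE sH /andP[_ /forall_inP cH].
have [/fintype.subsetP HE /forall_inP Hs] := andP sH.
apply/setP => A; rewrite inE; apply/idP/andP => [AH|[AE AS]].
  by split; [exact: HE | exact: Hs].
have /cards2P[u [v [uv AE2]]] : #|A| == 2%N by have /forall_inP := sE; exact.
subst A; have uS : u \in H.1 by apply: (fintype.subsetP AS); exact: finset.set21.
have vS : v \in H.1 by apply: (fintype.subsetP AS); exact: finset.set22.
apply: contraT => nH; have := tail_notin_side sE aE AE; rewrite inE => /negP[].
have := forall_inP (cH v vS) u uS; apply: connect_sub => a b ab.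
apply: connect1; apply: (adj_sub _ ab); apply/fintype.subsetP => B BH.
by rewrite in_setD1 HE // andbT; apply: contraTneq BH => ->.
Qed.

End InducedSubtrees.

(** * Brooms *)

Section Broom.
Variables (n m : nat).
Hypotheses (m_ge3 : (3 <= m)%N) (m_lt_n : (m < n)%N).
Implicit Types (i j k : 'I_n) (S : {set 'I_n}).

(** Parent of a vertex [j > 0], for the numbering of the broom in which the path is
    [0, ..., m - 1] and the leaves, attached to [m - 1], are [m, ..., n - 1]. *)
Definition par (j : nat) : nat := minn j.-1 m.-1.

Definition broom : {set {set 'I_n}} :=
  [set A | [exists i : 'I_n, exists j : 'I_n,
    (A == [set i; j]) && ((0 < j)%N && (i == par j :> nat))]]%SET.

Lemma adj_broom i j : adj broom i j =
  ((0 < j)%N && (i == par j :> nat)) || ((0 < i)%N && (j == par i :> nat)).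
Proof.
rewrite /adj inE; apply/existsP/orP => [[a /existsP[b /andP[/eqP e h]]]|[]h].
- by have [[-> ->]|[-> ->]] := set2_inj e; auto.
- by exists i; apply/existsP; exists j; rewrite eqxx.
- by exists j; apply/existsP; exists i; rewrite finset.setUC eqxx.
Qed.

Lemma par_lt j : (0 < j)%N -> (par j < j)%N.
Proof. by rewrite /par; lia. Qed.

Lemma adj_par j k : (0 < j)%N -> k = par j :> nat -> adj broom k j.
Proof. by move=> j0 e; rewrite adj_broom j0 e eqxx. Qed.

Lemma adj_broom_lt i j : adj broom i j -> (i < j)%N -> i = par j :> nat.
Proof.
rewrite adj_broom => /orP[/andP[_ /eqP //]|/andP[i0 /eqP ji]] ij.
by have := par_lt i0; rewrite -ji; lia.
Qed.

Lemma broom_simple : simple_edges broom.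
Proof.
apply/forall_inP => A; rewrite inE.
move=> /existsP[i /existsP[j /andP[/eqP-> /andP[j0 /eqP e]]]].
rewrite cards2; have := par_lt j0; rewrite -e.
move=> lt; suff -> : i != j by []; by apply: contraTneq lt => ->; rewrite ltnn.
Qed.

(** On a cycle, the largest vertex would have two distinct smaller neighbours, but
    its parent is the only one. *)
Lemma broom_acyclic : acyclic broom.
Proof.
move=> c /andP[cc uc]; rewrite leqNgt; apply/negP => sc.
have [x0 x0c] : exists x, x \in c.
  by case: c sc {cc uc} => // x c _; exists x; rewrite mem_head.
have [x xc xmax] : exists2 x, x \in c & forall y, y \in c -> (y <= x)%N.
  by exists [arg max_(y > x0 in c) (y : nat)]; case: arg_maxnP.
have [i c' ic] := rot_to xc.
move: cc uc sc; rewrite -(rot_cycle i) -(rot_uniq i) -(size_rot i) ic.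
have {}xmax y : y \in x :: c' -> (y <= x)%N.
  by rewrite -ic mem_rot; exact: xmax.
case: c' xmax {ic} => [|y c'] //= xmax /andP[xy].
rewrite rcons_path => /andP[_ zx] /and3P[xyc yc _].
case: c' zx yc xyc xmax => [|z0 c'] //= zx yc xyc xmax _.
set z := last z0 c' in zx.
have zc : z \in z0 :: c' by exact: mem_last.
have yz : y != z by apply: contraNneq yc => ->.
have lt w : w \in [:: y, z0 & c'] -> (w < x)%N.
  move=> wc; rewrite ltn_neqAle xmax ?andbT; last by rewrite in_cons wc orbT.
  by apply: contraNneq xyc => /val_inj <-.
have yx : adj broom y x by rewrite adjC.
have e1 := adj_broom_lt yx (lt y (mem_head _ _)).
have e2 : z = par x :> nat.
  by apply: adj_broom_lt zx _; apply: lt; rewrite in_cons zc orbT.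
by move/eqP: yz; apply; apply: val_inj; rewrite /= e1.
Qed.

(** Following parents leads from every vertex of [S] to [r]. *)
Lemma parent_closed_connected S (r : 'I_n) : r \in S ->
  (forall i, i \in S -> i != r ->
     (0 < i)%N /\ exists2 k, k \in S & k = par i :> nat) ->
  connected_graph S (induced broom S).
Proof.
move=> rS cl; apply/andP; split; first by apply/set0Pn; exists r.
have toR i : i \in S -> connect (adj (induced broom S)) i r.
  elim: {i}(i : nat) {-2}i (leqnn i) => [|d IH] i.
    rewrite leqn0 => /eqP i0 iS; have [->|ir] := eqVneq i r; first exact: connect0.
    by have [] := cl i iS ir; rewrite i0.
  move=> id iS; have [->|ir] := eqVneq i r; first exact: connect0.
  have [i0 [k kS ki]] := cl i iS ir.
  apply: connect_trans (IH k _ kS); last by have := par_lt i0; rewrite -ki; lia.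
  apply: connect1; rewrite adjC /adj inE; apply/andP; split.
    exact: (adj_par i0 ki).
  by rewrite finset.subUset !finset.sub1set kS iS.
apply/forall_inP => x xS; apply/forall_inP => y yS.
apply: connect_trans (toR x xS) _; rewrite connect_adjC; exact: toR.
Qed.

Lemma broom_tree : is_tree broom.
Proof.
have n0 : (0 < n)%N by lia.
split; [exact: broom_simple | | exact: broom_acyclic].
have -> : broom = induced broom finset.setT.
  by apply/setP => A; rewrite [RHS]inE finset.subsetT andbT.
apply: (parent_closed_connected (r := Ordinal n0)); first exact: finset.in_setT.
move=> i _ ir; have i0 : (0 < i)%N by rewrite lt0n.
split=> //; have lt : (par i < n)%N by apply: ltn_trans (par_lt i0) _.
by exists (Ordinal lt) => //; exact: finset.in_setT.
Qed.

(** A path vertex [k] separates the vertices below it from those above it. *)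
Lemma cut_vertex (H : {set 'I_n} * {set {set 'I_n}}) a b k :
  is_subgraph broom H -> connected_graph H.1 H.2 ->
  a \in H.1 -> b \in H.1 -> (a < k)%N -> (k <= b)%N -> (k < m)%N -> k \in H.1.
Proof.
move=> sH /andP[_ /forall_inP cH] aS bS ak kb km.
have ab := forall_inP (cH a aS) b bS.
have [|u [v [uv /= uk vk]]] := crossing_edge (A := fun i => (i < k)%N) ab ak.
  by rewrite -leqNgt.
have [uvE uS vS] := subgraph_sub sH uv.
have := adj_broom_lt uvE; rewrite /par => e.
suff -> : k = v by [].
by apply: val_inj => /=; move: uk vk e km; clear; lia.
Qed.

Lemma broom_lipschitz i j : adj broom i j -> (minn j m <= (minn i m).+1)%N.
Proof. rewrite adj_broom /par; lia. Qed.

Let v0 : 'I_n := Ordinal (leq_ltn_trans (leq0n m) m_lt_n).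
Let v2 : 'I_n := Ordinal (ltn_trans m_ge3 m_lt_n).
Let leaves : {set 'I_n} := [set i : 'I_n | (m <= i)%N]%SET.
Let trunk : {set 'I_n} := [set i : 'I_n | (i < m)%N]%SET.

Lemma card_leaves : #|leaves| = (n - m)%N.
Proof.
rewrite -sum1_card -[RHS]muln1 -sum_nat_const_nat big_geq_mkord.
by apply: eq_bigl => i; rewrite inE.
Qed.

(** A subtree that contains [v] and the first vertex also contains the third; the
    path on the first three vertices shows that the inequality is strict. *)
Lemma num_subtrees_far (v : 'I_n) : (2 < v)%N ->
  (num_subtrees broom v v0 < num_subtrees broom v2 v0)%N.
Proof.
move=> v_gt2; apply/proper_card/properP; split.
  apply/fintype.subsetP => H; rewrite !inE => /and4P[sH cH vH oH].
  by rewrite sH cH oH (cut_vertex (k := v2) sH cH oH vH) //; exact: ltnW.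
pose S : {set 'I_n} := [set i : 'I_n | (i <= 2)%N]%SET.
exists (S, induced broom S).
  rewrite !inE /= induced_subgraph andbT.
  apply: (parent_closed_connected (r := v0)); first by rewrite inE.
  move=> i; rewrite inE => i2 ir; have i0 : (0 < i)%N by rewrite lt0n.
  split=> //; have lt : (par i < n)%N by apply: ltn_trans (par_lt i0) _.
  by exists (Ordinal lt) => //; rewrite inE /= /par; lia.
by rewrite !inE /= (leqNgt v) v_gt2 !andbF.
Qed.

(** The path between the third vertex and the first one contains [u]. *)
Lemma num_subtrees_trunk (u : 'I_n) : (u <= 2)%N ->
  (num_subtrees broom v2 v0 <= num_subtrees broom v2 u)%N.
Proof.
move=> u2; apply/subset_leq_card/fintype.subsetP => H; rewrite !inE.
move=> /and4P[sH cH vH oH]; rewrite sH cH vH /=.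
have [u0|u0] := posnP u; first by rewrite (_ : u = v0) //; apply: val_inj.
by apply: (cut_vertex (k := u) sH cH oH vH) => //=; apply: leq_trans m_ge3.
Qed.

(** A subtree that contains the first vertex is either the whole path with a set of
    leaves, or an initial segment of the path. *)
Lemma num_subtrees_first_le : (num_subtrees broom v2 v0 <= 2 ^ (n - m) + m)%N.
Proof.
rewrite -card_leaves.
pose F1 := [set trunk :|: A | A in powerset leaves]%SET.
pose F2 := [set [set i : 'I_n | (i <= k)%N] | k : 'I_m]%SET.
pose N := [pred H | [&& is_subgraph broom H, connected_graph H.1 H.2,
  v2 \in H.1 & v0 \in H.1]].
have inj : {in N &, injective (@fst {set 'I_n} {set {set 'I_n}})}.
  move=> H H'; rewrite !inE => /and4P[s c _ _] /and4P[s' c' _ _] e.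
  have f := subtree_induced broom_simple broom_acyclic s c.
  have f' := subtree_induced broom_simple broom_acyclic s' c'.
  by case: H H' e f f' {s c s' c'} => [a b] [a' b'] /= -> -> ->.
rewrite /num_subtrees -/N -(card_in_image inj).
apply: leq_trans (_ : (#|F1 :|: F2| <= _)%N); last first.
  rewrite cardsU; apply: leq_trans (leq_subr _ _) _; apply: leq_add.
    by apply: leq_trans (leq_imset_card _ _) _; rewrite card_powerset.
  by apply: leq_trans (leq_imset_card _ _) _; rewrite card_ord.
apply: subset_leq_card; apply/fintype.subsetP => S0 /fintype.imageP[[S F] + ->] /=.
rewrite !inE /= => /and4P[sH cH oH vH].
have cut a b k := @cut_vertex (S, F) a b k sH cH.
have [[c cS cm]|noc] := pselect (exists2 c, c \in S & (m.-1 <= c)%N).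
  apply/orP; left; apply/imsetP; exists (S :&: leaves)%SET.
    by rewrite powersetE finset.subsetIr.
  apply/setP => i; rewrite !inE; case: (ltnP i m) => [im|_] /=; last by rewrite andbT.
  have [i0|i0] := posnP i; first by rewrite (_ : i = v0) //; apply: val_inj.
  by apply: (cut v0 c i) => //; apply: leq_trans cm; rewrite -ltnS prednK //; lia.
apply/orP; right; apply/imsetP.
have [b bS bmax] : exists2 b, b \in S & forall y, y \in S -> (y <= b)%N.
  by exists [arg max_(y > v0 in S) (y : nat)]; case: arg_maxnP.
have bm : (b < m)%N.
  rewrite ltnNge; apply/negP => mb; apply: noc; exists b => //.
  exact: leq_trans (leq_pred m) mb.
exists (Ordinal bm) => //; apply/setP => i; rewrite inE /=.
apply/idP/idP => [/bmax //|ib].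
have [i0|i0] := posnP i; first by rewrite (_ : i = v0) //; apply: val_inj.
by apply: (cut v0 b i) => //; exact: leq_ltn_trans bm.
Qed.

(** Choose a start [j] among the first three vertices, take the path from [j] to
    its end with one leaf [l], equal to [u] if [u] is a leaf, and add any set of
    other leaves.  All these subtrees contain [u] and the third vertex. *)
Lemma num_subtrees_right_ge (u : 'I_n) : (2 <= u)%N ->
  (3 * 2 ^ (n - m).-1 <= num_subtrees broom v2 u)%N.
Proof.
move=> u2.
have lastP : (n.-1 < n)%N by rewrite prednK //; apply: leq_ltn_trans m_lt_n.
pose l : 'I_n := if (m <= u)%N then u else Ordinal lastP.
have lm : (m <= l)%N.
  by rewrite /l; case: ifP => //= _; rewrite -ltnS prednK //; apply: leq_ltn_trans m_lt_n.
pose B := leaves :\ l.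
have cB : #|B| = (n - m).-1.
  by rewrite -card_leaves (cardsD1 l leaves) inE lm.
pose S (jA : 'I_3 * {set 'I_n}) : {set 'I_n} :=
  ([set i : 'I_n | (jA.1 <= i < m)%N] :|: (l |: jA.2))%SET.
pose D := finset.setX [set: 'I_3]%SET (powerset B).
have cD : #|D| = (3 * 2 ^ (n - m).-1)%N.
  by rewrite cardsX cardsT card_ord card_powerset cB.
have inj : {in D &, injective S}.
  move=> [j A] [j' A']; rewrite !finset.in_setX !powersetE /=.
  move=> /andP[_ /fintype.subsetP AB] /andP[_ /fintype.subsetP AB'] /setP e.
  have nB i : (i < m)%N -> (i \notin A) * (i \notin A') * (i != l).
    move=> im; have nl : i \notin leaves by rewrite inE -ltnNge.
    have nb : i \notin B by rewrite in_setD1 (negbTE nl) andbF.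
    split; first by split; apply: contra nb; [exact: AB | exact: AB'].
    by apply: contraTneq im => ->; rewrite -leqNgt.
  have lt3 (k : 'I_3) : (k < m)%N by apply: leq_trans m_ge3.
  have cmp (k : 'I_3) : (j <= k)%N = (j' <= k)%N.
    have kn : (k < n)%N by apply: ltn_trans m_lt_n.
    have := e (Ordinal kn); rewrite !inE /= lt3 !andbT.
    have [[/negbTE -> /negbTE ->] /negbTE ->] := nB (Ordinal kn) (lt3 k).
    by rewrite !orbF.
  have jj : j = j'.
    apply: val_inj; apply/eqP; rewrite eqn_leq; have := cmp j; have := cmp j'.
    by rewrite !leqnn => -> <-.
  congr pair => //; apply/setP => i.
  have inB (C : {set 'I_n}) : {subset C <= B} -> i \in C -> (m <= i)%N && (i != l).
    by move=> CB /CB; rewrite !inE andbC.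
  have [im|im] := ltnP i m.
    by have [[/negbTE -> /negbTE ->] _] := nB i im.
  have [il|il] := eqVneq i l.
    apply/idP/idP => [/(inB _ AB)|/(inB _ AB')]; by rewrite il eqxx andbF.
  by have := e i; rewrite !inE (negbTE il) ltnNge im !andbF.
rewrite -cD -(card_in_imset inj).
have inj2 : injective (fun S => (S, induced broom S)) by move=> a b [].
rewrite -(card_imset _ inj2) /num_subtrees; apply: subset_leq_card.
apply/fintype.subsetP => H /imsetP[S0 /imsetP[[j A] + ->] ->].
rewrite finset.in_setX powersetE /= => /andP[_ /fintype.subsetP AB].
have AL i : i \in A -> (m <= i)%N by move=> /AB; rewrite !inE => /andP[].
have j2 : (j <= 2)%N by rewrite -ltnS.
have jn : (j < n)%N by apply: leq_ltn_trans j2 (ltn_trans m_ge3 m_lt_n).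
rewrite !inE induced_subgraph /= j2 m_ge3 /=; apply/andP; split; last first.
  have [mu|um] := leqP m u; last by rewrite (leq_trans j2 u2).
  by rewrite /l mu eqxx orbT.
apply: (parent_closed_connected (r := Ordinal jn)).
  by rewrite !inE /= leqnn (leq_ltn_trans j2).
move=> i iS ij.
have ji : (j < i)%N.
  rewrite ltn_neqAle eq_sym; apply/andP; split.
    by apply: contra ij => /eqP e; apply/eqP/val_inj.
  move: iS; rewrite !inE => /or3P[/andP[] //|/eqP->|/AL].
    by apply: leq_trans lm; apply: leq_trans j2 (ltnW m_ge3).
  by apply: leq_trans; apply: leq_trans j2 (ltnW m_ge3).
have i0 : (0 < i)%N by apply: leq_ltn_trans ji.
split=> //; have lt : (par i < n)%N by apply: ltn_trans (par_lt i0) _.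
exists (Ordinal lt) => //; rewrite !inE /= /par.
by apply/orP; left; move: ji j2 m_ge3; clear; lia.
Qed.

Hypothesis many_leaves : (m <= 2 ^ (n - m).-1)%N.

(** The first vertex realises the eccentric subtree number of the third, and beyond
    the third vertex it shares fewer subtrees. *)
Lemma core_center_broom (v : 'I_n) : v \in core_center broom -> (v <= 2)%N.
Proof.
rewrite inE => /forallP/(_ v2); apply: contraTT; rewrite -!ltnNge => v_gt2.
apply: leq_ltn_trans (bigminn_le _ _ (mem_index_enum v0) isT) _.
apply: leq_trans (num_subtrees_far v_gt2) _.
have le u : (num_subtrees broom v2 v0 <= num_subtrees broom v2 u)%N.
  have [u2|/ltnW u2] := leqP u 2; first exact: num_subtrees_trunk.
  apply: leq_trans num_subtrees_first_le (leq_trans _ (num_subtrees_right_ge u2)).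
  have -> : (n - m = (n - m).-1.+1)%N by rewrite prednK // subn_gt0.
  rewrite expnS /=; move: many_leaves; set X := (2 ^ _)%N; clear; lia.
by apply: bigminn_ge.
Qed.

Variable R : realType.

(** The heights [minn i m] of a characteristic vertex [x] and of the last path
    vertex differ by at most [(n + 1) / 2], while the core center has height at
    most 2. *)
Lemma broom_distance :
  (n <= 2 * set_dist broom (char_center R broom) (core_center broom) +
        2 * (n - m) + 7)%N.
Proof.
have n2 : (2 <= n)%N by apply: leq_trans (ltnW m_ge3) (ltnW m_lt_n).
have cB := is_tree_connected broom_tree.
have lip := tree_dist_lipschitz cB broom_lipschitz.
have mN : (m.-1 < n)%N by apply: leq_ltn_trans (leq_pred m) m_lt_n.
pose c := Ordinal mN.
suff bound : ((n - 2 * (n - m) - 7).+1./2 <=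
    set_dist broom (char_center R broom) (core_center broom))%N.
  by move: bound; set d := set_dist _ _ _; clear; lia.
apply: bigminn_ge => [|x xC]; first by rewrite card_ord; lia.
apply: bigminn_ge => [|y yC]; first by rewrite card_ord; lia.
have e := char_center_dist broom_tree n2 c xC.
have [lc _] := lip x c; have [_ ly] := lip x y.
rewrite /= in lc.
have y2 := core_center_broom yC.
move: e lc ly y2 m_lt_n; clear; lia.
Qed.

End Broom.

(** * The limit *)

Section Delta.
Variables (R : realType) (n : nat).

Lemma delta_upper : (2 <= n)%N -> (2 * delta_char_core R n <= n.+1)%N.
Proof.
move=> n2; suff : (delta_char_core R n <= n.+1 %/ 2)%N.
  by rewrite leq_divRL // mulnC.
apply/bigmax_leqP => E /asboolP tE; rewrite leq_divRL // mulnC.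
have cE := is_tree_connected tE.
have [x xC] := char_center_nonempty R tE n2.
have [y yC] := core_center_nonempty E x.
apply: leq_trans (char_center_dist tE n2 y xC).
by rewrite leq_mul2l set_dist_le.
Qed.

(** The broom with [g] leaves: the hypothesis on [n] provides enough subsets of
    leaves compared with the length of the path. *)
Lemma delta_lower g : (g + 3 <= n)%N -> (n <= 2 ^ g.-1)%N ->
  (n <= 2 * delta_char_core R n + 2 * g + 7)%N.
Proof.
move=> gn ng.
have g0 : (0 < g)%N by case: g gn ng => //; case: n => [|[]].
have m3 : (3 <= n - g)%N by rewrite leq_subRL; lia.
have mn : (n - g < n)%N by lia.
have ngg : (n - (n - g) = g)%N by rewrite subKn //; lia.
have ml : (n - g <= 2 ^ (n - (n - g)).-1)%N.
  by rewrite ngg; apply: leq_trans ng; exact: leq_subr.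
have := broom_distance m3 mn ml R; rewrite ngg => le.
apply: leq_trans le _; rewrite !leq_add2r leq_mul2l /=.
apply: (leq_bigmax_cond
  (F := fun E => set_dist E (char_center R E) (core_center E))).
by apply/asboolP; exact: broom_tree.
Qed.

End Delta.

(** With [t = trunc_log 2 n], this makes [t] at most twice the square root of [n],
    hence negligible compared with [n]. *)
Lemma sqr_le_exp2 t : (t ^ 2 <= 4 * 2 ^ t)%N.
Proof.
elim: t => // -[|[|[|t]]] // IH.
rewrite expnS mulnCA; apply: leq_trans (leq_mul (leqnn 2) IH).
rewrite !expnS !expn0; nia.
Qed.

Local Open Scope classical_set_scope.

Theorem proposition5p22 (R : realType) :
  (delta_char_core R n)%:R / n%:R @[n --> \oo] --> (1 / 2 : R).
Proof.
apply/cvgrPdist_le => e e0.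
near=> n.
have n8 : (8 <= n)%N by near: n; exact: nbhs_infty_ge.
have ne : 16 / e ^+ 2 <= n%:R :> R by near: n; exact: nbhs_infty_ger.
have ne' : 11 / e <= n%:R :> R by near: n; exact: nbhs_infty_ger.
(* the broom has t + 2 leaves, so that n <= 2 ^ (t + 1) *)
pose t := trunc_log 2 n.
have n0 : (0 < n)%N by apply: leq_trans n8.
have tn : (2 ^ t <= n)%N by apply: trunc_logP.
have nt : (n < 2 ^ t.+1)%N by apply: trunc_log_ltn.
have t3 : (3 <= t)%N by rewrite -(@trunc_expnK 2 3) // leq_trunc_log.
have t5 : (t + 5 <= 2 ^ t)%N.
  elim: t t3 {tn nt} => // t IH; rewrite leq_eqVlt => /predU1P[<- //|/IH].
  by rewrite expnS; lia.
have up : (2 * delta_char_core R n <= n.+1)%N.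
  by apply: delta_upper; apply: leq_trans n8.
have lo : (n <= 2 * delta_char_core R n + 2 * t.+2 + 7)%N.
  by apply: delta_lower; [lia | exact: ltnW].
have t2 : (t ^ 2 <= 4 * n)%N.
  by apply: leq_trans (sqr_le_exp2 t) _; rewrite leq_mul2l.
set d := delta_char_core R n in up lo *.
have nR : 0 < n%:R :> R by rewrite ltr0n.
have upR : 2 * d%:R <= n%:R + 1 :> R by rewrite -natrM natr1 ler_nat.
have loR : n%:R <= 2 * d%:R + 2 * t%:R + 11 :> R.
  by rewrite -!natrM -!natrD ler_nat; move: lo; clear; lia.
have ttR : t%:R ^+ 2 <= 4 * n%:R :> R by rewrite -natrX -natrM ler_nat.
have e11 : 11 <= e * n%:R by rewrite mulrC -ler_pdivrMr.
have e16 : 16 <= e ^+ 2 * n%:R by rewrite mulrC -ler_pdivrMr // exprn_gt0.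
have te : 2 * t%:R <= e * n%:R.
  rewrite -(@ler_pXn2r _ 2) ?nnegrE ?mulr_ge0 ?(ltW e0) //.
  have := ler_wpM2r (ltW nR) e16; rewrite !exprMn [n%:R ^+ 2]expr2 mulrA.
  by move: ttR; lra.
rewrite ler_distl; apply/andP; split.
  by rewrite lerBlDr ler_pdivrMr //; move: upR e11; lra.
by rewrite -lerBlDr ler_pdivlMr //; move: loR te e11; lra.
Unshelve. all: by end_near.
Qed.
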